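(* Let $\mathcal{P}$ be a finite set of atomic propositions and let $n\in\mathbb{N}$. For all inquisitive modal models $\mathcal{M}=(W,\Sigma,V)$ and $\mathcal{M}'=(W',\Sigma',V')$ over $\mathcal{P}$, all information states $s\subseteq W$, $s'\subseteq W'$ and all worlds $w\in W$, $w'\in W'$: (i) $\mathcal{M},s\sim^n\mathcal{M}',s'$ if and only if $\mathcal{M},s\equiv^n_{\mathrm{InqML}}\mathcal{M}',s'$; (ii) $\mathcal{M},w\sim^n\mathcal{M}',w'$ if and only if $\mathcal{M},w\equiv^n_{\mathrm{InqML}}\mathcal{M}',w'$.
   Context: An inquisitive modal model over a set $\mathcal{P}$ of atoms is a triple $\mathcal{M}=(W,\Sigma,V)$ where $W$ is a set (of worlds), $V:\mathcal{P}\to\wp(W)$, and $\Sigma:W\to\wp\wp(W)$ assigns to each world a non-empty, downward closed (under subsets) set $\Sigma(w)$ of subsets of $W$. Subsets of $W$ are called information states. Put $\sigma(w):=\bigcup\Sigma(w)$. Formulae of InqML: $\varphi::=p\mid\bot\mid(\varphi\wedge\varphi)\mid(\varphi\to\varphi)\mid(\varphi\,\bar\vee\,\varphi)\mid\Box\varphi\mid\boxplus\varphi$ with $p\in\mathcal{P}$ ($\bar\vee$ is ''inquisitive disjunction''); $\neg\varphi:=\varphi\to\bot$, $\varphi\vee\psi:=\neg(\neg\varphi\wedge\neg\psi)$. Support at a state $s\subseteq W$: $\mathcal{M},s\models p$ iff $s\subseteq V(p)$; $\mathcal{M},s\models\bot$ iff $s=\emptyset$; $\wedge$ is conjunction of support;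 $\mathcal{M},s\models\varphi\to\psi$ iff for all $t\subseteq s$, $\mathcal{M},t\models\varphi$ implies $\mathcal{M},t\models\psi$; $\mathcal{M},s\models\varphi\bar\vee\psi$ iff $\mathcal{M},s\models\varphi$ or $\mathcal{M},s\models\psi$; $\mathcal{M},s\models\Box\varphi$ iff $\mathcal{M},\sigma(w)\models\varphi$ for all $w\in s$; $\mathcal{M},s\models\boxplus\varphi$ iff $\mathcal{M},t\models\varphi$ for all $w\in s$ and all $t\in\Sigma(w)$. Truth at a world: $\mathcal{M},w\models\varphi$ iff $\mathcal{M},\{w\}\models\varphi$. The modal depth of a formula is the maximal nesting of the modalities $\Box,\boxplus$; $\mathrm{InqML}_n$ is the set of formulae of modal depth $\le n$. $\mathcal{M},s\equiv^n_{\mathrm{InqML}}\mathcal{M}',s'$ means that for all $\varphi\in\mathrm{InqML}_n$, $\mathcal{M},s\models\varphi\iff\mathcal{M}',s'\models\varphi$; analogously for worlds (using truth). Bisimulation game between $\mathcal{M}$ and $\mathcal{M}'$: positions are world-positions $(w,w')\in W\times W'$ or state-positions $(s,s')\in\wp(W)\times\wp(W')$. From a world-position, player I picks $s\in\Sigma(w)$ or $s'\in\Sigma'(w')$ and player II must answer with a state in $\Sigma'(w')$ resp. $\Sigma(w)$ on the other side, giving a state-position $(s,s')$. From a state-position, I picks a world in $s$ or in $s'$ and II must answer with a world in the other state, giving a world-position. A round consists of these four moves leading from a world-position to a world-position. A player who cannot move loses; II loses at any world-position $(w,w')$ where $w,w'$ disagree on some atom $p$ (i.e. $w\in V(p)\not\Leftrightarrow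 w'\in V'(p)$); all other plays (including those ending after the prescribed number of rounds and infinite plays) are won by II. $\mathcal{M},w\sim^n\mathcal{M}',w'$ iff II has a winning strategy in the $n$-round game starting at $(w,w')$. For states, $\mathcal{M},s\sim^n\mathcal{M}',s'$ iff every world of $s$ is $n$-bisimilar to some world of $s'$ and vice versa. *)

(* Defs.v *)
From mathcomp Require Import all_boot.
From mathcomp Require Import boolp classical_sets.
Set Implicit Arguments.
Unset Strict Implicit.
Unset Printing Implicit Defensive.
Local Open Scope classical_set_scope.

Record model (P : Type) := Model {
  world :> Type;
  inqstate : world -> set (set world);
  valuation : P -> set world;
  inqstate_nonempty : forall w, inqstate w !=set0;
  inqstate_downward : forall w (s t : set world),
    inqstate w s -> t `<=` s -> inqstate w t
}.

Arguments valuation {P} m p _.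

Definition accessible (P : Type) (M : model P) (w : M) : set M :=
  \bigcup_(t in inqstate w) t.

(* [InqOr] is inquisitive disjunction; [Window] is the modality written as a
   boxed plus. *)
Inductive formula (P : Type) : Type :=
| Atom of P
| Bot
| And of formula P & formula P
| Imp of formula P & formula P
| InqOr of formula P & formula P
| Box of formula P
| Window of formula P.

Arguments Bot {P}.

Fixpoint modal_depth (P : Type) (phi : formula P) : nat :=
  match phi with
  | Atom _ | Bot => 0
  | And a b | Imp a b | InqOr a b => maxn (modal_depth a) (modal_depth b)
  | Box a | Window a => (modal_depth a).+1
  end.

Fixpoint support (P : Type) (M : model P) (s : set M) (phi : formula P)
    : Prop :=
  match phi with
  | Atom p => s `<=` valuation M p
  | Bot => s = set0
  | And a b => support s a /\ support s b
  | Imp a b => forall t : set M, t `<=` s -> support t a -> support t b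
  | InqOr a b => support s a \/ support s b
  | Box a => forall w, s w -> support (accessible w) a
  | Window a => forall w, s w -> forall t, inqstate w t -> support t a
  end.

Definition truth (P : Type) (M : model P) (w : M) (phi : formula P) : Prop :=
  support [set w] phi.

Definition state_equiv (P : Type) (n : nat) (M M' : model P)
    (s : set M) (s' : set M') : Prop :=
  forall phi : formula P, modal_depth phi <= n ->
    (support s phi <-> support s' phi).

Definition world_equiv (P : Type) (n : nat) (M M' : model P)
    (w : M) (w' : M') : Prop :=
  forall phi : formula P, modal_depth phi <= n ->
    (truth w phi <-> truth w' phi).

(* World-positions and state-positions, together with the four kinds of
   intermediate positions reached after a move of player I.  The suffix L or R
   is the side on which player II must answer; the chosen object on the other
   side is recorded next to what II has to answer for. *)
Inductive position (P : Type) (M M' : model P) : Type :=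
| WorldPos (w : M) (w' : M')
| AnswerStateR (s : set M) (w' : M')
| AnswerStateL (w : M) (s' : set M')
| StatePos (s : set M) (s' : set M')
| AnswerWorldR (w : M) (s' : set M')
| AnswerWorldL (s : set M) (w' : M').

Arguments WorldPos {P M M'}.
Arguments AnswerStateR {P M M'}.
Arguments AnswerStateL {P M M'}.
Arguments StatePos {P M M'}.
Arguments AnswerWorldR {P M M'}.
Arguments AnswerWorldL {P M M'}.

Inductive player := PlayerI | PlayerII.

Definition turn (P : Type) (M M' : model P) (p : position M M') : player :=
  match p with
  | WorldPos _ _ | StatePos _ _ => PlayerI
  | _ => PlayerII
  end.

Inductive move (P : Type) (M M' : model P) :
    position M M' -> position M M' -> Prop :=
| MoveStateL w w' s of inqstate w s :
    move (WorldPos w w') (AnswerStateR s w')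
| MoveStateR w w' s' of inqstate w' s' :
    move (WorldPos w w') (AnswerStateL w s')
| ReplyStateR s w' s' of inqstate w' s' :
    move (AnswerStateR s w') (StatePos s s')
| ReplyStateL w s' s of inqstate w s :
    move (AnswerStateL w s') (StatePos s s')
| MoveWorldL (s : set M) (s' : set M') w of s w :
    move (StatePos s s') (AnswerWorldR w s')
| MoveWorldR (s : set M) (s' : set M') w' of s' w' :
    move (StatePos s s') (AnswerWorldL s w')
| ReplyWorldR w (s' : set M') w' of s' w' :
    move (AnswerWorldR w s') (WorldPos w w')
| ReplyWorldL (s : set M) w' w of s w :
    move (AnswerWorldL s w') (WorldPos w w').

Definition atom_mismatch (P : Type) (M M' : model P) (p : position M M')
    : Prop :=
  match p with
  | WorldPos w w' => exists a : P, ~ (valuation M a w <-> valuation M' a w')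
  | _ => False
  end.

(* A strategy for player II maps the play so far, a list of positions with the
   current one first, to the next position.  It is a total function: an illegal
   answer counts as having no move. *)
Definition strategy (P : Type) (M M' : model P) : Type :=
  seq (position M M') -> position M M'.

Inductive play (P : Type) (M M' : model P) (tau : strategy M M')
    (p0 : position M M') : seq (position M M') -> Prop :=
| PlayStart : play tau p0 [:: p0]
| PlayI p q h of play tau p0 (p :: h) & turn p = PlayerI
    & ~ atom_mismatch p & move p q : play tau p0 (q :: p :: h)
| PlayII p h of play tau p0 (p :: h) & turn p = PlayerII
    & move p (tau (p :: h)) : play tau p0 (tau (p :: h) :: p :: h).

(* [size h] is the number of moves made in the play [p :: h], and a round
   consists of four moves. *)
Definition winning_strategy (P : Type) (n : nat) (M M' : model P)
    (p0 : position M M') (tau : strategy M M') : Prop :=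
  forall p h, play tau p0 (p :: h) -> size h <= 4 * n ->
    ~ atom_mismatch p /\ (turn p = PlayerII -> move p (tau (p :: h))).

Definition world_bisim (P : Type) (n : nat) (M M' : model P)
    (w : M) (w' : M') : Prop :=
  exists tau : strategy M M', winning_strategy n (WorldPos w w') tau.

Definition state_bisim (P : Type) (n : nat) (M M' : model P)
    (s : set M) (s' : set M') : Prop :=
  (forall w, s w -> exists2 w', s' w' & world_bisim n w w') /\
  (forall w', s' w' -> exists2 w, s w & world_bisim n w w').

(* Main.v *)
(** Over finitely many atoms there are finitely many "n-types" of worlds: a
    0-type is a set of atoms, an (n+1)-type is a set of atoms together with a set
    of sets of n-types.  Two worlds are n-bisimilar iff they have the same n-type,
    and two states are iff they realise the same set of n-types.  Support of
    formulae of depth at most n only depends on the realised n-types; conversely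
    each n-type is defined by a formula of depth n.  The inductive step of the
    latter rests on downward closure: a set X of n-types is realised exactly by
    some state of [inqstate w] iff not every state of [inqstate w] misses some
    member of X, which is a negated window over an inquisitive disjunction. *)
From mathcomp Require Import all_boot.
From mathcomp Require Import boolp classical_sets.
Require Import Defs.
Set Implicit Arguments.
Unset Strict Implicit.
Unset Printing Implicit Defensive.
Local Open Scope classical_set_scope.

(** * The game *)

Section Game.
Variables (P : Type) (M M' : model P).
Implicit Types (p q : position M M').

(* Player II can survive [m] further moves from [p]. *)
Fixpoint good (m : nat) p : Prop :=
  ~ atom_mismatch p /\
  match m, turn p with
  | 0, PlayerI => True
  | 0, PlayerII => exists q, move p q
  | m.+1, PlayerI => forall q, move p q -> good m q
  | m.+1, PlayerII => exists2 q, move p q & good m q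
  end.

Lemma good_mismatch m p : good m p -> ~ atom_mismatch p.
Proof. by case: m => [|m] []. Qed.

(** Even with budget 0 a reply must exist, since [winning_strategy] demands one after exactly
    [4 * n] moves. *)
Lemma good_reply m p : good m p -> turn p = PlayerII -> exists q, move p q.
Proof. by case: m => [|m] [_] + tp; rewrite tp // => -[q pq _]; exists q. Qed.

(** Moves made and moves left share the budget [4 * n]; induction on the moves left extends the
    play. *)
Lemma good_of_winning n p0 tau : winning_strategy n p0 tau ->
  forall m p h, play tau p0 (p :: h) -> size h + m <= 4 * n -> good m p.
Proof.
move=> win; elim=> [|m IHm] p h plp hm.
  have [mis rep] := win p h plp (leq_trans (leq_addr _ _) hm).
  split=> //; case tp : (turn p) => //.
  by exists (tau (p :: h)); apply: rep.
have [mis rep] := win p h plp (leq_trans (leq_addr _ _) hm).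
split=> //; case tp : (turn p).
  by move=> q pq; apply: (IHm q (p :: h)); [apply: PlayI | rewrite addSnnS].
exists (tau (p :: h)); first exact: rep.
by apply: (IHm _ (p :: h)); [apply: PlayII => //; apply: rep | rewrite addSnnS].
Qed.

Lemma winning_of_good n p0 :
  good (4 * n) p0 -> exists tau : strategy M M', winning_strategy n p0 tau.
Proof.
move=> g0; set m := 4 * n in g0.
(* After [m] moves a reply only has to be legal, hence the guard on [size h]. *)
pose ok p (h : seq (position M M')) q := move p q /\ (size h < m -> good (m - (size h).+1) q).
(* Choice needs a value at every list: the dummies are [p0] at the empty list and [p] where no
   acceptable reply exists. *)
have /choice[tau tauP] : forall l : seq (position M M'), exists q,
    if l is p :: h then (exists q', ok p h q') -> ok p h q else True.
  case=> [|p h]; first by exists p0.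
  have [[q okq]|none] := pselect (exists q', ok p h q'); first by exists q.
  by exists p => /none.
have okP p h : size h <= m -> good (m - size h) p -> turn p = PlayerII ->
    ok p h (tau (p :: h)).
  move=> hm gp tp; apply: (tauP (p :: h)).
  have [hlt|hge] := ltnP (size h) m.
    move: gp; rewrite -[m - size h]prednK ?subn_gt0 //= tp -subnS => -[_ [q]].
    by exists q.
  have [q pq] := good_reply gp tp.
  by exists q; split=> //; rewrite ltnNge hge.
have inv l : play tau p0 l ->
    if l is p :: h then size h <= m -> good (m - size h) p else True.
  elim=> [|p q h _ IH tp _ pq|p h _ IH tp _] /=; first by rewrite subn0.
    move=> hm; move: (IH (ltnW hm)).
    by rewrite -[m - size h]prednK ?subn_gt0 //= tp -subnS => -[_]; apply.
  by move=> hm; apply: (okP _ _ (ltnW hm) (IH (ltnW hm)) tp).2.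
exists tau => p h plp hm; have gp := inv _ plp hm.
by split=> [|tp]; [exact: good_mismatch gp | exact: (okP p h hm gp tp).1].
Qed.

Lemma world_bisimE n (w : M) (w' : M') :
  world_bisim n w w' <-> good (4 * n) (WorldPos w w').
Proof.
split=> [[tau win]|]; last exact: winning_of_good.
exact: (good_of_winning win (PlayStart _ _)).
Qed.

Lemma not_mismatchE (w : M) (w' : M') :
  ~ atom_mismatch (WorldPos w w') <->
  forall a, valuation M a w <-> valuation M' a w'.
Proof.
split=> [nm a|eqa [a]]; last by apply; exact: eqa.
by apply: contrapT => na; apply: nm; exists a.
Qed.

Lemma world_bisim0 (w : M) (w' : M') :
  world_bisim 0 w w' <-> forall a, valuation M a w <-> valuation M' a w'.
Proof. by rewrite world_bisimE -not_mismatchE /=; tauto. Qed.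

Lemma world_bisimS n (w : M) (w' : M') :
  world_bisim n.+1 w w' <->
  [/\ forall a, valuation M a w <-> valuation M' a w',
      forall s, inqstate w s -> exists2 s', inqstate w' s' & state_bisim n s s' &
      forall s', inqstate w' s' -> exists2 s, inqstate w s & state_bisim n s s'].
Proof.
(* Second half of a round: two moves lead to a world-position with [4 * n] moves left. *)
have goodS (s : set M) (s' : set M') :
    good (4 * n).+2 (StatePos s s') <-> state_bisim n s s'.
  split.
    move=> [_ gs]; split=> [v sv|v' sv'].
      have [_ /= [q mq gq]] := gs _ (MoveWorldL s' sv).
      by inversion mq; subst; exists w'0 => //; apply/world_bisimE.
    have [_ /= [q mq gq]] := gs _ (MoveWorldR s sv').
    by inversion mq; subst; exists w0 => //; apply/world_bisimE.
  move=> [fo ba]; split=> [[]|q mq]; inversion mq; subst; split=> //=.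
    have [v' sv' /world_bisimE gv] := fo _ H2.
    by exists (WorldPos w0 v') => //; constructor.
  have [v sv /world_bisimE gv] := ba _ H2.
  by exists (WorldPos v w'0) => //; constructor.
rewrite world_bisimE mulnS; split.
  move=> [/not_mismatchE eqa gw]; split=> // [s ws|s' ws'].
    have [_ /= [q mq gq]] := gw _ (MoveStateL w' ws).
    by inversion mq; subst; exists s' => //; apply/goodS.
  have [_ /= [q mq gq]] := gw _ (MoveStateR w ws').
  by inversion mq; subst; exists s => //; apply/goodS.
move=> [/not_mismatchE eqa fo ba]; split=> //= q mq.
inversion mq; subst; split=> //=.
  have [s' ws' /goodS gs] := fo _ H2.
  by exists (StatePos s s') => //; constructor.
have [s ws /goodS gs] := ba _ H2.
by exists (StatePos s s') => //; constructor.
Qed.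

End Game.

(** * Types of worlds *)

(** Its values lie in a [finType], so it can be iterated: from types of worlds to types of states,
    then to sets of these. *)
Definition fsimage (W : Type) (T : finType) (f : W -> T) (s : set W) : {set T} :=
  finset (fun a => `[< exists2 v, s v & f v = a >]).

Lemma fsimageP (W : Type) (T : finType) (f : W -> T) (s : set W) a :
  reflect (exists2 v, s v & f v = a) (a \in fsimage f s).
Proof. by rewrite inE; exact: asboolP. Qed.

Lemma sub_fsimage (W : Type) (T : finType) (f : W -> T) (s : set W) (X : {set T}) :
  X \subset fsimage f s -> exists2 t, t `<=` s & fsimage f t = X.
Proof.
move=> /fintype.subsetP sX; exists (fun v => s v /\ f v \in X); first by move=> v [].
apply/setP => a; apply/fsimageP/idP => [[v [_ vX] <-] //|aX].
by have /fsimageP[v sv fv] := sX _ aX; exists v; rewrite ?fv.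
Qed.

Lemma fsimage_eq (W W' : Type) (T : finType) (f : W -> T) (g : W' -> T)
    (s : set W) (s' : set W') :
  fsimage f s = fsimage g s' <->
  (forall v, s v -> exists2 v', s' v' & f v = g v') /\
  (forall v', s' v' -> exists2 v, s v & f v = g v').
Proof.
split=> [eqs|[fo ba]].
  split=> [v sv|v' sv'].
    have /fsimageP[v' sv' gv'] : f v \in fsimage g s'.
      by rewrite -eqs; apply/fsimageP; exists v.
    by exists v'.
  have /fsimageP[v sv fv] : g v' \in fsimage f s.
    by rewrite eqs; apply/fsimageP; exists v'.
  by exists v.
apply/setP => a; apply/fsimageP/fsimageP => [[v sv <-]|[v' sv' <-]].
  by have [v' sv' ->] := fo v sv; exists v'.
by have [v sv <-] := ba v' sv'; exists v.
Qed.

Fixpoint bisim_type (P : finType) (n : nat) : finType :=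
  if n is m.+1 then ({set P} * {set {set bisim_type P m}})%type else {set P}.

Definition atoms (P : finType) (M : model P) (w : M) : {set P} :=
  finset (fun a => `[< valuation M a w >]).

Lemma atomsP (P : finType) (M : model P) (w : M) a :
  reflect (valuation M a w) (a \in atoms w).
Proof. by rewrite inE; exact: asboolP. Qed.

Fixpoint wtype (P : finType) (n : nat) (M : model P) : M -> bisim_type P n :=
  match n with
  | 0 => fun w => atoms w
  | m.+1 => fun w => (atoms w, fsimage (fsimage (@wtype P m M)) (inqstate w))
  end.

Definition stype (P : finType) (n : nat) (M : model P) : set M -> {set bisim_type P n} :=
  fsimage (@wtype P n M).

Section Types.
Variable P : finType.
Implicit Types M : model P.

Lemma atoms_eq M M' (w : M) (w' : M') :
  atoms w = atoms w' <-> forall a, valuation M a w <-> valuation M' a w'.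
Proof.
split=> [eqa a|eqa]; last by apply/setP => a; apply/atomsP/atomsP => /eqa.
by split=> /atomsP; [rewrite eqa|rewrite -eqa] => /atomsP.
Qed.

(** Both sides obey the same recursion: [world_bisimS] is matched by [fsimage_eq], used once for
    families of states and once for states. *)
Lemma wtype_bisim n M M' (w : M) (w' : M') :
  world_bisim n w w' <-> wtype n w = wtype n w'.
Proof.
elim: n M M' w w' => [|n IHn] M M' w w'; first by rewrite world_bisim0 -atoms_eq.
have sE (s : set M) (s' : set M') :
    state_bisim n s s' <-> fsimage (wtype n (M:=M)) s = fsimage (wtype n (M:=M')) s'.
  rewrite fsimage_eq; split=> -[fo ba]; split=> v sv.
  - by have [v' ? /IHn] := fo v sv; exists v'.
  - by have [v' ? /IHn] := ba v sv; exists v'.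
  - by have [v' ? /IHn] := fo v sv; exists v'.
  - by have [v' ? /IHn] := ba v sv; exists v'.
rewrite world_bisimS; split.
  move=> [/atoms_eq eqa fo ba] /=; congr pair => //; apply/fsimage_eq.
  split=> s ws; first by have [s' ? /sE] := fo s ws; exists s'.
  by have [s' ? /sE] := ba s ws; exists s'.
move=> /= [/atoms_eq eqa /fsimage_eq[fo ba]]; split=> // s ws.
  by have [s' ? /sE] := fo s ws; exists s'.
by have [s' ? /sE] := ba s ws; exists s'.
Qed.

Lemma stype_bisim n M M' (s : set M) (s' : set M') :
  state_bisim n s s' <-> stype n s = stype n s'.
Proof.
rewrite fsimage_eq; split=> -[fo ba]; split=> v sv.
- by have [v' ? /wtype_bisim] := fo v sv; exists v'.
- by have [v' ? /wtype_bisim] := ba v sv; exists v'.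
- by have [v' ? /wtype_bisim] := fo v sv; exists v'.
- by have [v' ? /wtype_bisim] := ba v sv; exists v'.
Qed.

(** * Invariance of support under equality of types *)

Lemma stype_subset n M M' (s : set M) (s' t' : set M') :
  stype n s = stype n s' -> t' `<=` s' ->
  exists2 t, t `<=` s & stype n t = stype n t'.
Proof.
move=> eqs ts; apply: sub_fsimage; rewrite -/(stype n s) eqs.
by apply/fintype.subsetP => a /fsimageP[v tv va]; apply/fsimageP; exists v; first exact: ts.
Qed.

(** The types in [accessible w] form the union of the members of the second component of the type of
    [w]. *)
Lemma stype_accessible n M M' (w : M) (w' : M') :
  wtype n.+1 w = wtype n.+1 w' -> stype n (accessible w) = stype n (accessible w').
Proof.
move=> /= [_ /fsimage_eq[fo ba]]; apply/fsimage_eq; split=> v [s ws sv].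
  have [s' ws' /fsimage_eq[+ _]] := fo s ws.
  by move=> /(_ v sv)[v' sv' ?]; exists v' => //; exists s'.
have [s' ws' /fsimage_eq[_ +]] := ba s ws.
by move=> /(_ v sv)[v' sv' ?]; exists v' => //; exists s'.
Qed.

(** One direction suffices, as the models may be swapped. They stay general in the induction because
    the antecedent of an implication is carried back from [s'] to [s]; modalities lower [n]. *)
Lemma support_stype phi n M M' (s : set M) (s' : set M') :
  modal_depth phi <= n -> stype n s = stype n s' -> support s phi -> support s' phi.
Proof.
elim: phi n M M' s s' => /=
  [p||a IHa b IHb|a IHa b IHb|a IHa b IHb|a IHa|a IHa] n M M' s s'.
- move=> _ /fsimage_eq[_ ba] sp v' /ba[v sv].
  by move=> /wtype_bisim; case: n {ba} => [/world_bisim0|n /world_bisimS[]] e;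
    move=> *; apply/e/sp.
- move=> _ /fsimage_eq[_ ba] s0; rewrite -subset0 => v' /ba[v].
  by rewrite s0.
- rewrite geq_max => /andP[an bn] eqs [sa sb].
  by split; [exact: IHa eqs sa | exact: IHb eqs sb].
- rewrite geq_max => /andP[an bn] eqs sab t' ts' ta'.
  have [t ts eqt] := stype_subset eqs ts'.
  by apply: (IHb n _ _ t t' bn eqt); apply: sab => //; exact: IHa (esym eqt) ta'.
- rewrite geq_max => /andP[an bn] eqs [sa|sb].
    by left; exact: IHa eqs sa.
  by right; exact: IHb eqs sb.
- case: n => // n an /fsimage_eq[_ ba] sa v' /ba[v sv eqv].
  exact: IHa an (stype_accessible eqv) (sa v sv).
- case: n => // n an /fsimage_eq[_ ba] sa v' /ba[v sv [_ /fsimage_eq[_ ba']]] t' vt'.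
  have [t vt eqt] := ba' t' vt'.
  exact: IHa an eqt (sa v sv t vt).
Qed.

(** * Definability of types *)

(** One formula serves all models and is truth-conditional: support at a state amounts to [Q] at
    each world. [InqOr] need not preserve this. *)
Definition definable n (Q : forall M, M -> Prop) :=
  exists2 phi : formula P, modal_depth phi <= n &
    forall M (s : set M), support s phi <-> forall v, s v -> Q M v.

Lemma definable_ext n (Q R : forall M, M -> Prop) :
  (forall M (v : M), Q M v <-> R M v) -> definable n Q -> definable n R.
Proof.
move=> QR [phi dphi phiP]; exists phi => // M s; rewrite phiP.
by split=> H v /H /QR.
Qed.

Lemma definable_atom n p : definable n (fun M => valuation M p).
Proof. by exists (Atom p). Qed.

Lemma definable_imp n (Q R : forall M, M -> Prop) :
  definable n Q -> definable n R -> definable n (fun M v => Q M v -> R M v).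
Proof.
move=> [f df fP] [g dg gP]; exists (Imp f g); first by rewrite /= geq_max df.
move=> M s /=; split=> [H v sv Qv|H t ts /fP tQ]; last first.
  by apply/gP => v tv; apply: H; [exact: ts | exact: tQ].
have /gP : support [set v] g by apply: H => [_ -> //|]; apply/fP => _ ->.
by apply.
Qed.

Lemma definable_and n (Q R : forall M, M -> Prop) :
  definable n Q -> definable n R -> definable n (fun M v => Q M v /\ R M v).
Proof.
move=> [f df fP] [g dg gP]; exists (And f g); first by rewrite /= geq_max df.
move=> M s /=; rewrite fP gP; split=> [[H K] v sv|H].
  by split; [exact: H | exact: K].
by split=> v /H[].
Qed.

Lemma definable_False n : definable n (fun M v => False).
Proof.
exists Bot => // M s /=; split=> [-> //|s0].
by rewrite -subset0.
Qed.

(** A classical case distinction picks a tautology or [Bot]; this lets membership conditions enter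
    formulae. *)
Lemma definable_const n (A : Prop) : definable n (fun M v => A).
Proof.
have [a|na] := pselect A.
  apply: definable_ext (definable_imp (definable_False n) (definable_False n)).
  by [].
by apply: definable_ext (definable_False n).
Qed.

Lemma definable_iff n (Q R : forall M, M -> Prop) :
  definable n Q -> definable n R -> definable n (fun M v => Q M v <-> R M v).
Proof. by move=> dQ dR; apply: definable_and; apply: definable_imp. Qed.

(** A conjunction along [enum T]; finiteness of atoms and of types enters here. *)
Lemma definable_forall n (T : finType) (Q : T -> forall M, M -> Prop) :
  (forall i, definable n (Q i)) -> definable n (fun M v => forall i, Q i M v).
Proof.
move=> dQ.
suff: definable n (fun M v => forall i, i \in enum T -> Q i M v).
  by apply: definable_ext => M v; split=> H i; [apply: H; rewrite mem_enum | move=> _].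
elim: (enum T) => [|i r IHr].
  by apply: definable_ext (definable_const n True).
apply: definable_ext (definable_and (dQ i) IHr) => M v; split.
  by move=> [Qi Qr] j; rewrite inE => /predU1P[->|/Qr].
by move=> H; split=> [|j jr]; apply: H; rewrite inE ?eqxx ?jr ?orbT.
Qed.

(* The disjunction has to be nonempty: every formula is supported by the empty
   state. *)
Lemma inq_disjunction n (T : eqType) (Q : T -> forall M, M -> Prop) i0 r :
  (forall i, definable n (Q i)) ->
  exists2 phi : formula P, modal_depth phi <= n &
    forall M (s : set M), support s phi <->
      exists2 i, i \in i0 :: r & forall v, s v -> Q i M v.
Proof.
move=> dQ; elim: r i0 => [|j r IHr] i0; have [f df fP] := dQ i0.
  exists f => // M s; rewrite fP; split=> [H|[i]]; first by exists i0; rewrite ?inE.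
  by rewrite inE => /eqP->.
have [g dg gP] := IHr j; exists (InqOr f g); first by rewrite /= geq_max df.
move=> M s /=; rewrite fP gP; split.
  move=> [H|[i ir H]]; first by exists i0; rewrite ?inE ?eqxx.
  by exists i => //; rewrite inE ir orbT.
by move=> [i]; rewrite inE => /predU1P[->|ir] H; [left | right; exists i].
Qed.

(** [Window] is truth-conditional whatever its argument, so an inquisitive disjunction may stand
    below it. *)
Lemma definable_window n (f : formula P) : modal_depth f <= n ->
  definable n.+1 (fun M v => forall t, inqstate v t -> support t f).
Proof. by move=> df; exists (Window f). Qed.

(** By downward closure, a state realising more types than [X] shrinks to one realising exactly
    [X]. *)
Lemma inqstate_stypeP n M (w : M) (X : {set bisim_type P n}) :
  X \in (wtype n.+1 w).2 <-> exists2 t, inqstate w t & X \subset stype n t.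
Proof.
split=> [/fsimageP[t wt <-]|[t wt /sub_fsimage[u ut uX]]]; first by exists t.
by apply/fsimageP; exists u => //; exact: inqstate_downward wt ut.
Qed.

Lemma definable_inqstate n (X : {set bisim_type P n}) :
  (forall a, definable n (fun M v => wtype n v = a)) ->
  definable n.+1 (fun M v => X \in (wtype n.+1 v).2).
Proof.
move=> dty; case EX : (enum X) => [|a0 r].
  (* The empty [X] is realised by the empty state, which lies in every [inqstate v]. *)
  have X0 : X = finset.set0 by apply/setP => a; rewrite -mem_enum EX !inE.
  apply: definable_ext (definable_const _ True) => M v; split=> // _.
  apply/inqstate_stypeP; have [t vt] := inqstate_nonempty v.
  by exists t => //; rewrite X0 finset.sub0set.
have dn a : definable n (fun M v => wtype n v <> a).
  exact: definable_imp (dty a) (definable_False n).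
(* [f] says that the state misses some member of [X]. *)
have [f df fP] := inq_disjunction a0 r dn.
apply: definable_ext
  (definable_imp (definable_window df) (definable_False n.+1)) => M v.
rewrite inqstate_stypeP; split=> [nw|[t vt /fintype.subsetP Xt] /(_ t vt) /fP[a]].
  apply: contrapT => nX; apply: nw => t vt; apply/fP.
  have /fintype.subsetPn[a aX at_] : ~~ (X \subset stype n t).
    by apply/negP => Xt; apply: nX; exists t.
  exists a; first by rewrite -EX mem_enum.
  by move=> u tu ua; move/negP: at_; apply; apply/fsimageP; exists u.
rewrite -EX mem_enum => /Xt /fsimageP[u tu ua] /(_ u tu).
exact.
Qed.

Lemma definable_atoms n (A : {set P}) : definable n (fun M v => atoms v = A).
Proof.
have d p := definable_iff (definable_atom n p) (definable_const n (p \in A)).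
apply: definable_ext (definable_forall d) => M v; split=> [eqA|<- p].
  by apply/setP => p; apply/atomsP/idP => /eqA.
by split=> /atomsP.
Qed.

(** A successor type [(A, F)] is fixed by its atoms and by deciding, for each of finitely many [X],
    whether some state realises it. *)
Lemma definable_wtype n a : definable n (fun M v => wtype n v = a).
Proof.
elim: n a => [|n IHn] a; first exact: definable_atoms.
case: a => A F.
have d X := definable_iff (definable_inqstate X IHn) (definable_const _ (X \in F)).
apply: definable_ext (definable_and (definable_atoms _ A) (definable_forall d)).
move=> M v; split=> [[vA vF]|[vA vF]].
  by rewrite /= vA; congr pair; apply/setP => X; apply/idP/idP => /vF.
by split=> // X; rewrite /= vF.
Qed.

(** A conjunction of implications over all types avoids a disjunction. *)
Lemma definable_mem_wtype n (X : {set bisim_type P n}) :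
  definable n (fun M v => wtype n v \in X).
Proof.
have d a := definable_imp (definable_wtype a) (definable_const n (a \in X)).
by apply: definable_ext (definable_forall d) => M v; split=> [|vX a <-]; first exact.
Qed.

(** * From modal equivalence to equal types *)

Lemma state_equiv_stype_subset n M M' (s : set M) (s' : set M') :
  state_equiv n s s' -> stype n s' \subset stype n s.
Proof.
(* The test formula confines all worlds to the types realised in [s], so it passes from [s] to
   [s']. *)
move=> eqs; have [f df fP] := definable_mem_wtype (stype n s).
have /(eqs f df) /fP ss' : support s f.
  by apply/fP => v sv; apply/fsimageP; exists v.
by apply/fintype.subsetP => a /fsimageP[v sv <-]; exact: ss'.
Qed.

Lemma state_equivE n M M' (s : set M) (s' : set M') :
  state_equiv n s s' <-> stype n s = stype n s'.
Proof.
split=> [eqs|eqs phi dphi].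
  apply/eqP; rewrite finset.eqEsubset !state_equiv_stype_subset // => phi dphi.
  by split=> /(eqs phi dphi).
by split; apply: support_stype dphi _.
Qed.

End Types.

Theorem theorem4p1 (P : finType) (n : nat) (M M' : model P)
    (s : set M) (s' : set M') (w : M) (w' : M') :
  (state_bisim n s s' <-> state_equiv n s s') /\
  (world_bisim n w w' <-> world_equiv n w w').
Proof.
split; first by rewrite stype_bisim state_equivE.
(* Truth is support at a singleton, and singletons realise the same types iff their worlds have
   equal type. *)
have -> : world_equiv n w w' = state_equiv n [set w] [set w'] by [].
rewrite state_equivE wtype_bisim /stype fsimage_eq.
split=> [eqw|[/(_ w erefl)[_ ->]] //].
by split=> _ ->; [exists w' | exists w].
Qed.
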